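(* Let $1\le p<q$ and let $r,s>0$ be such that $\frac qp-\frac qr\ge 1$ and $\frac1p>\frac1q+\frac1s$. Define $\alpha,\beta$ by $$\alpha=q\left(\frac1p-\frac1s-\frac1q\right),\qquad \beta^{-1}=q\left(\frac1p-\frac1r\right),$$ with $\alpha\le 1\le\beta^{-1}$. Assume that $\|\widehat N_n-N_n\|_p\le v_n$, $\|\widehat D_n-D_n\|_q\le v_n$, and that $\|U_{i,n}V_{i,n}\|_r\le C_n$ and $\|V_{i,n}\|_s\le c_n$ for all $1\le i\le n$. Then $$D_n\|\Delta_n\|_p\le\left(1+\frac{|N_n|}{D_n}+\frac{|N_n|^\beta v_n^{1-\beta}}{D_n}+\frac{C_n^\beta v_n^{1-\beta}}{D_n}+\frac{v_n^\alpha c_n n^{1/s}}{D_n^\alpha}\right)v_n .$$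
   Context: $(U_{i,n})$ and $(V_{i,n})$, $1\le i\le n$, are arrays of real random variables with $U_{i,n}\ge 0$. Set $\widehat D_n=\frac1n\sum_{i=1}^nU_{i,n}$, $\widehat N_n=\frac1n\sum_{i=1}^nU_{i,n}V_{i,n}$, $\widehat R_n=\widehat N_n/\widehat D_n$ (with the convention $0/0=0$), $N_n=\mathbb E\widehat N_n$, $D_n=\mathbb E\widehat D_n>0$, $R_n=N_n/D_n$ and $\Delta_n=\widehat R_n-R_n$. The quantities $v_n,C_n,c_n$ are positive deterministic numbers. $\|Z\|_p=(\mathbb E|Z|^p)^{1/p}$. *)

(* Defs.v *)
From HB Require Import structures.
From mathcomp Require Import all_boot all_order all_algebra.
From mathcomp Require Import all_classical all_reals all_analysis.
Set Implicit Arguments.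
Unset Strict Implicit.
Unset Printing Implicit Defensive.
Import Order.TTheory GRing.Theory Num.Theory.
Import numFieldNormedType.Exports.
Local Open Scope classical_set_scope.
Local Open Scope ring_scope.

Section ratio.
Context d (T : measurableType d) (R : realType) (P : probability T R).
Variables (n : nat) (U V : 'I_n -> {RV P >-> R}).

Definition Dhat (x : T) : R := n%:R^-1 * \sum_(i < n) U i x.

Definition Nhat (x : T) : R := n%:R^-1 * \sum_(i < n) U i x * V i x.

(* Since x / 0 = 0, this includes the convention 0 / 0 = 0; for nonnegative
   weights U, Dhat x = 0 forces Nhat x = 0. *)
Definition Rhat (x : T) : R := Nhat x / Dhat x.

(* fine sends +oo to 0, so for almost surely nonnegative U the hypothesis
   0 < Dbar states that E Dhat is both finite and positive. *)
Definition Dbar : R := fine 'E_P[Dhat].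

Definition Nbar : R := fine 'E_P[Nhat].

Definition Rbar : R := Nbar / Dbar.

Definition Delta (x : T) : R := Rhat x - Rbar.

End ratio.

(* Main.v *)
Require Import Defs.
From HB Require Import structures.
From mathcomp Require Import all_boot all_order all_algebra.
From mathcomp Require Import all_classical all_reals all_analysis.
From mathcomp Require Import measurable_realfun.
From mathcomp Require Import ring.
Set Implicit Arguments.
Unset Strict Implicit.
Unset Printing Implicit Defensive.
Import Order.TTheory GRing.Theory Num.Theory.
Import numFieldNormedType.Exports.
Local Open Scope classical_set_scope.
Local Open Scope ring_scope.

(** The proof splits the error pointwise and bounds the [p]-norm of each piece.
    Write [X], [Y] for the empirical denominator and numerator, [D], [N] for
    their means and [rho = Y / X], so that
    [D (rho - N / D) = (Y - N) - (X - D) rho].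
    The first term has [p]-norm at most [v]. In the second one, bounding [|rho|]
    at once by the maximum of the [|V i|] would lose the factor [(v / D)^alpha];
    instead [rho] is first compared with [Y / D], the price being a power of the
    relative error:
    [|rho| <= |Y| / D + (|X - D| / D)^alpha |rho|]
    ([norm_le_relative_error]). As [|Y| <= |N| + |Y - N|], three products remain.

    - [|N| / D * |X - D|] is controlled by [v], the [q]-norm dominating the
      [p]-norm on a probability space.
    - [|X - D| |Y - N| / D] is treated by Hoelder's inequality with exponents [q]
      and [m], where [1/p = 1/q + 1/m]. The number [beta] is the one for which
      [1/m = (1 - beta)/p + beta/r], so the [m]-norm of [Y - N] interpolates
      ([Lnorm_interpolation]) between its [p]-norm, at most [v], and its
      [r]-norm, at most [C + |N|] by Minkowski's inequality; finally
      [(C + |N|)^beta <= C^beta + |N|^beta].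
    - [|X - D|^(1 + alpha) |rho| / D^alpha] is treated by Hoelder's inequality
      with exponents [q / (1 + alpha)] and [s]; the number [alpha] is the one for
      which their inverses add up to [1/p]. As a weighted mean of the [V i],
      [rho] is at most the maximum of the [|V i|], hence at most their [l^s] norm
      [(\sum_i |V i|^s)^(1/s)], whose [s]-norm is at most [c n^(1/s)]. *)

(** * Pointwise estimates *)

Section real_facts.
Context {R : realType}.
Implicit Types a b t : R.
Implicit Types D N X Y M rho alpha : R.

(** By concavity each summand [x] of [a + b] satisfies
    [x / (a + b) <= (x / (a + b))^t]; the two left sides add up to 1. *)
Lemma powRD_subadd a b t : 0 <= a -> 0 <= b -> 0 < t -> t <= 1 ->
  (a + b) `^ t <= a `^ t + b `^ t.
Proof.
move=> a0 b0 t0 t1.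
have [a0'|aN0] := eqVneq a 0; first by rewrite a0' powR0 ?gt_eqF// !add0r.
have [b0'|bN0] := eqVneq b 0.
  by rewrite b0' (@powR0 _ t) ?gt_eqF// !addr0.
have ap : 0 < a by rewrite lt_neqAle eq_sym aN0.
have bp : 0 < b by rewrite lt_neqAle eq_sym bN0.
have abp : 0 < a + b by rewrite addr_gt0.
have frac x : 0 < x -> x <= a + b -> x / (a + b) * (a + b) `^ t <= x `^ t.
  move=> x0 xab.
  rewrite [leRHS](_ : _ = (x / (a + b)) `^ t * (a + b) `^ t); last first.
    by rewrite -powRM ?divr_ge0 ?ltW// divfK ?gt_eqF.
  rewrite ler_wpM2r ?powR_ge0//; apply: ger1_powR => //.
  by rewrite divr_gt0//= ler_pdivrMr// mul1r.
have -> : (a + b) `^ t =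
    a / (a + b) * (a + b) `^ t + b / (a + b) * (a + b) `^ t.
  by rewrite -mulrDl -mulrDl mulfV ?gt_eqF// mul1r.
by apply: lerD; apply: frac; rewrite ?lerDl ?lerDr.
Qed.

(** With [u = (D - X) / D] the claim is [|rho| <= |(1 - u) rho| + |u|^alpha |rho|].
    For [|u| <= 1] it is the triangle inequality, as [|u| <= |u|^alpha]; for
    [|u| > 1] the last term alone suffices, as [|u|^alpha >= 1]. *)
Lemma norm_le_relative_error D X rho alpha :
  0 < D -> 0 < alpha -> alpha <= 1 ->
  `|rho| <= `|X * rho| / D + `|X - D| `^ alpha / D `^ alpha * `|rho|.
Proof.
move=> D0 a0 a1; pose u : R := `|X - D| / D.
have u0 : 0 <= u by rewrite divr_ge0// ltW.
have -> : `|X - D| `^ alpha / D `^ alpha = u `^ alpha.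
  rewrite /u powRM// ?invr_ge0 ?(ltW D0)//.
  by rewrite -(powR_inv1 (ltW D0)) powRAC powR_inv1 ?powR_ge0.
have [u1|u1] := leP u 1; last first.
  apply: (@le_trans _ _ (u `^ alpha * `|rho|)); last first.
    by rewrite lerDr divr_ge0// ltW.
  by rewrite ler_peMl// -[leLHS](powRr0 u) ler_powR// ltW.
have rhoE : rho = X * rho / D + (D - X) / D * rho.
  by field; rewrite gt_eqF.
rewrite {1}rhoE; apply: (le_trans (ler_normD _ _)).
rewrite normrM normfV [`|_ / _ * _|]normrM [`|(D - X) / D|]normrM normfV.
rewrite (gtr0_norm D0) distrC -/u lerD2l ler_wpM2r//.
have [->|uN0] := eqVneq u 0; first exact: powR_ge0.
by apply: ger1_powR a1; rewrite u1 andbT lt_neqAle eq_sym uN0.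
Qed.

(** The pointwise form of the moment bound, with [X], [Y] the empirical
    denominator and numerator. It comes from
    [D (Y / X - N / D) = (Y - N) - (X - D) (Y / X)], the factor [Y / X] of the
    last term being estimated by [norm_le_relative_error]. The assumption
    [|Y| <= X M] forces [Y = 0] when [X = 0], so that [Y = X (Y / X)] always. *)
Lemma norm_ratio_error_le D N X Y M alpha : 0 < D -> 0 <= X -> 0 <= M ->
  `|Y| <= X * M -> 0 < alpha -> alpha <= 1 ->
  `|D * (Y / X - N / D)| <= `|Y - N| + (`|N| / D * `|X - D|
    + (D^-1 * (`|X - D| * `|Y - N|)
      + (D `^ alpha)^-1 * (`|X - D| `^ (1 + alpha) * M))).
Proof.
move=> D0 X0 M0 YXM a0 a1.
have rhoM : `|Y / X| <= M.
  have [->|XN0] := eqVneq X 0; first by rewrite invr0 mulr0 normr0.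
  have Xp : 0 < X by rewrite lt_neqAle eq_sym XN0.
  by rewrite normrM normfV (ger0_norm X0) ler_pdivrMr// mulrC.
have YE : Y = X * (Y / X).
  have [X00|XN0] := eqVneq X 0; last by rewrite mulrC divfK.
  by move: YXM; rewrite X00 !mul0r normr_le0 => /eqP.
have := norm_le_relative_error X (Y / X) D0 a0 a1; rewrite -YE => rho_le.
set rho := Y / X in rhoM YE rho_le *; clearbody rho.
have -> : D * (rho - N / D) = (Y - N) - (X - D) * rho.
  by rewrite YE; field; rewrite gt_eqF.
apply: (le_trans (ler_normB _ _)); rewrite lerD2l normrM.
apply: (le_trans (ler_wpM2l (normr_ge0 _) rho_le)).
have a1N0 : 1 + alpha != 0 by rewrite gt_eqF// addr_gt0.
rewrite powRD ?(negPf a1N0)// powRr1//.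
have Y_le : `|Y| <= `|N| + `|Y - N| by rewrite -{1}(subrKC N Y) ler_normD.
have x_ge0 : 0 <= `|X - D| by [].
move: (`|X - D|) x_ge0 (`|Y - N|) Y_le => x x_ge0 y Y_le.
have Da_ge0 : 0 <= (D `^ alpha)^-1 by rewrite invr_ge0 powR_ge0.
have xa_ge0 : 0 <= x `^ alpha := powR_ge0 _ _.
set xa := x `^ alpha in xa_ge0 *; set Da := D `^ alpha in Da_ge0 *.
have -> : x * (`|Y| / D + xa / Da * `|rho|) =
    D^-1 * x * `|Y| + Da^-1 * (x * xa * `|rho|) by ring.
have -> : `|N| / D * x + (D^-1 * (x * y) + Da^-1 * (x * xa * M)) =
    D^-1 * x * (`|N| + y) + Da^-1 * (x * xa * M) by ring.
apply: lerD; last by do 2 rewrite ler_wpM2l ?mulr_ge0//.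
by rewrite ler_wpM2l// mulr_ge0// invr_ge0 ltW.
Qed.

Lemma norm_weighted_sum_le (n : nat) (u w : 'I_n -> R) M :
  (forall i, 0 <= u i) -> (forall i, `|w i| <= M) ->
  `|n%:R^-1 * \sum_(i < n) u i * w i| <= n%:R^-1 * (\sum_(i < n) u i) * M.
Proof.
move=> u0 wM; rewrite normrM ger0_norm ?invr_ge0// -mulrA ler_wpM2l ?invr_ge0//.
rewrite mulr_suml; apply: (le_trans (ler_norm_sum _ _ _)); apply: ler_sum => i _.
by rewrite normrM (ger0_norm (u0 i)) ler_wpM2l.
Qed.

Lemma norm_le_sum_powR (n : nat) (w : 'I_n -> R) (s : R) (i : 'I_n) : 0 < s ->
  `|w i| <= (\sum_(j < n) `|w j| `^ s) `^ s^-1.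
Proof.
move=> s0; have sum0 (P : pred 'I_n) : 0 <= \sum_(j < n | P j) `|w j| `^ s.
  by apply: sumr_ge0 => j _; exact: powR_ge0.
rewrite -[leLHS]powRr1// -(mulfV (lt0r_neq0 s0)) powRrM.
rewrite ge0_ler_powR ?nnegrE ?invr_ge0 ?powR_ge0 ?sum0 ?(ltW s0)//.
by rewrite (bigD1 i)//= lerDl sum0.
Qed.

End real_facts.

Lemma poweR_le_powR (R : realType) (x : \bar R) (y t : R) :
  0 <= t -> (0 <= x)%E -> (x <= y%:E)%E -> (x `^ t <= (y `^ t)%:E)%E.
Proof.
move=> t0 x0 xy; rewrite -poweR_EFin; apply: gt0_ler_poweR => //.
- by rewrite in_itv/= x0 leey.
- by rewrite in_itv/= (le_trans x0 xy) leey.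
Qed.

(** * L^p norms of real-valued functions *)

Section Lnorm_facts.
Context d (T : measurableType d) (R : realType) (mu : {measure set T -> \bar R}).
Local Open Scope ereal_scope.
Implicit Types (f g : T -> R) (p a b t : R).

Local Notation "'N_ p [ f ]" := (Lnorm mu p%:E (EFin \o f)).

Lemma LnormE f p : 'N_p[f] = (\int[mu]_x (`|f x| `^ p)%:E) `^ p^-1.
Proof. by rewrite unlock. Qed.

Lemma measurable_norm_powR f p : measurable_fun setT f ->
  measurable_fun setT (fun x => `|f x| `^ p)%R.
Proof.
move=> mf; apply: (@measurableT_comp _ _ _ _ _ _ (@powR R ^~ p)) => //.
exact: measurableT_comp.
Qed.

Lemma measurable_fun_inv f :
  measurable_fun setT f -> measurable_fun setT (fun x => (f x)^-1)%R.
Proof.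
move=> mf.
(* [y^-1 = y * |y|^(-2)] reduces inversion to the measurable power function;
   both sides are 0 at [y = 0]. *)
rewrite (_ : (fun _ => _) =
    (fun x => f x * (`|f x| `^ (-1) * `|f x| `^ (-1)))%R).
  by do !apply: measurable_funM => //; exact: measurable_norm_powR.
apply/funext => x; rewrite powR_inv1// -invfM -expr2 real_normK ?num_real//.
have [->|fx0] := eqVneq (f x) 0%R; first by rewrite mul0r invr0.
by rewrite expr2 invfM mulrA mulfV// mul1r.
Qed.

Lemma le_Lnorm f g p : measurable_fun setT f -> measurable_fun setT g ->
  (0 < p)%R -> {ae mu, forall x, (`|f x| <= `|g x|)%R} -> 'N_p[f] <= 'N_p[g].
Proof.
move=> mf mg p0 fg; rewrite !LnormE.
have ge0 h : 0 <= \int[mu]_x (`|h x| `^ p)%:E.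
  by apply: integral_ge0 => x _; rewrite lee_fin powR_ge0.
apply: gt0_ler_poweR; rewrite ?invr_ge0 ?(ltW p0) ?in_itv/= ?ge0 ?leey//.
apply: ae_ge0_le_integral => //.
- exact/measurable_EFinP/measurable_norm_powR.
- exact/measurable_EFinP/measurable_norm_powR.
- by apply: filterS fg => x fgx _; rewrite lee_fin ge0_ler_powR// ?nnegrE// ltW.
Qed.

(** Minkowski's inequality for finitely many functions, in the form in which a
    pointwise almost sure estimate is integrated. *)
Lemma Lnorm_le_sum (I : Type) (l : seq I) (F : I -> T -> R) f p :
  measurable_fun setT f -> (forall i, measurable_fun setT (F i)) -> (1 <= p)%R ->
  {ae mu, forall x, (`|f x| <= \sum_(i <- l) `|F i x|)%R} ->
  'N_p[f] <= \sum_(i <- l) 'N_p[F i].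
Proof.
move=> mf mF p1 fF; have p0 := lt_le_trans ltr01 p1.
have mnF i : measurable_fun setT (fun x => `|F i x|)%R by exact: measurableT_comp.
have mS l' : measurable_fun setT (fun x => \sum_(i <- l') `|F i x|)%R.
  exact: measurable_sum.
apply: (le_trans (le_Lnorm mf (mS l) p0 _)).
  by apply: filterS fF => x /le_trans; apply; exact: ler_norm.
elim: l {fF} => [|i l IH].
  under [X in EFin \o X]eq_fun do rewrite big_nil.
  by rewrite big_nil Lnorm0// gt_eqF// lte_fin.
under [X in EFin \o X]eq_fun do rewrite big_cons.
rewrite big_cons; apply: le_trans (leeD (lexx _) IH).
rewrite -(Lnorm_abse _ (EFin \o F i)).
exact: (minkowski_EFin mu (mnF i) (mS l) p1).
Qed.

Lemma LnormZl f c p : measurable_fun setT f -> (0 < p)%R ->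
  'N_p[(fun x => c * f x)%R] = `|c|%:E * 'N_p[f].
Proof.
move=> mf p0; rewrite !LnormE.
under eq_integral do rewrite normrM powRM ?normr_ge0// EFinM.
rewrite ge0_integralZl_EFin ?powR_ge0//; last first.
  exact/measurable_EFinP/measurable_norm_powR.
rewrite poweRM ?lee_fin ?powR_ge0//; last first.
  by apply: integral_ge0 => x _; rewrite lee_fin powR_ge0.
by rewrite poweR_EFin -powRrM mulfV ?gt_eqF// powRr1.
Qed.

Lemma Lnorm_powR f a t : (0 < a)%R -> (0 < t)%R ->
  'N_a[(fun x => `|f x| `^ t)%R] = 'N_(t * a)[f] `^ t.
Proof.
move=> a0 t0; rewrite !LnormE -poweRrM invfM mulrAC mulVf ?gt_eqF// mul1r.
congr (_ `^ _); apply: eq_integral => x _.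
by rewrite ger0_norm ?powR_ge0// powRrM.
Qed.

(** Hoelder's inequality with a general exponent [p] on the left: apply the usual
    one, with the conjugate exponents [a / p] and [b / p], to [|f|^p] and
    [|g|^p]. *)
Lemma Lnorm_mul_le f g p a b :
  measurable_fun setT f -> measurable_fun setT g ->
  (0 < p)%R -> (0 < a)%R -> (0 < b)%R -> (p^-1 = a^-1 + b^-1)%R ->
  'N_p[(f \* g)%R] <= 'N_a[f] * 'N_b[g].
Proof.
move=> mf mg p0 a0 b0 pab.
have := @hoelder _ _ _ mu _ _ (a / p) (b / p)
  (measurable_norm_powR p mf) (measurable_norm_powR p mg).
rewrite !divr_gt0// => /(_ isT isT).
rewrite !invf_div -mulrDr -pab mulfV ?gt_eqF// => /(_ erefl).
rewrite !Lnorm_powR ?divr_gt0// ![(p * (_ / p))%R]mulrC !divfK ?gt_eqF//.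
rewrite (_ : _ \* _ = fun x => `|f x * g x| `^ p)%R; last first.
  by apply/funext => x/=; rewrite normrM powRM.
rewrite (Lnorm_powR (fun x => f x * g x)%R)// mulr1 -poweRM ?Lnorm_ge0//.
move=> /(gt0_ler_poweR (r := p^-1)).
rewrite !in_itv/= invr_ge0 (ltW p0) !poweR_ge0 !leey => /(_ isT isT isT).
by rewrite -!poweRrM mulfV ?gt_eqF// !poweRe1 ?mule_ge0 ?Lnorm_ge0.
Qed.

(** Write [|f| = |f|^(1 - t) |f|^t] and apply [Lnorm_mul_le] with the exponents
    [p / (1 - t)] and [r / t]. *)
Lemma Lnorm_interpolation f p r m t :
  measurable_fun setT f -> (0 < p)%R -> (0 < r)%R -> (0 < m)%R ->
  (0 < t)%R -> (t <= 1)%R -> (m^-1 = (1 - t) / p + t / r)%R ->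
  'N_m[f] <= 'N_p[f] `^ (1 - t) * 'N_r[f] `^ t.
Proof.
move=> mf p0 r0 m0 t0 t1 mE.
(* For [t = 1] the exponent [p / (1 - t)] is meaningless, but [m = r]. *)
have [t1'|tN1] := eqVneq t 1%R.
  move: mE; rewrite t1' subrr mul0r add0r mul1r => /invr_inj ->.
  by rewrite poweRe0 mul1e poweRe1 ?Lnorm_ge0.
have u0 : (0 < 1 - t)%R by rewrite subr_gt0 lt_neqAle tN1.
have := @Lnorm_mul_le _ _ m (p / (1 - t)) (r / t)
  (measurable_norm_powR (1 - t) mf) (measurable_norm_powR t mf) m0.
rewrite !divr_gt0// !invf_div => /(_ isT isT mE).
rewrite !Lnorm_powR ?divr_gt0// ![(_ * (_ / _))%R]mulrC !divfK ?gt_eqF//.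
rewrite (_ : EFin \o _ = abse \o (EFin \o f)) ?Lnorm_abse//.
apply/funext => x /=; congr (_%:E); rewrite -powRD ?subrK ?oner_eq0//.
by rewrite powRr1.
Qed.

(** The [l^p] norm of a family stands in for its maximum: its [p]-th power is a
    sum, so the integral splits over the family. *)
Lemma Lnorm_sum_powR_le (I : finType) (F : I -> T -> R) p (c : R) :
  (0 < p)%R -> (0 <= c)%R -> (forall i, measurable_fun setT (F i)) ->
  (forall i, 'N_p[F i] <= c%:E) ->
  'N_p[(fun x => (\sum_i `|F i x| `^ p) `^ p^-1)%R] <= (c * #|I|%:R `^ p^-1)%:E.
Proof.
move=> p0 c0 mF Fc; have pV0 : (0 < p^-1)%R by rewrite invr_gt0.
rewrite LnormE; under eq_integral.
  move=> x _; rewrite ger0_norm ?powR_ge0// -powRrM mulVf ?gt_eqF// powRr1.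
    rewrite -sumEFin; over.
  by apply: sumr_ge0 => i _; exact: powR_ge0.
rewrite ge0_integral_sum//; last first.
  by move=> i; exact/measurable_EFinP/measurable_norm_powR.
have -> : (c * #|I|%:R `^ p^-1 = (#|I|%:R * c `^ p) `^ p^-1)%R.
  by rewrite powRM ?powR_ge0// -powRrM mulfV ?gt_eqF// powRr1// mulrC.
apply: poweR_le_powR; [exact: ltW| |].
  by apply: sume_ge0 => i _; apply: integral_ge0 => x _; rewrite lee_fin powR_ge0.
have -> : (#|I|%:R * c `^ p)%:E = \sum_(i : I) (c `^ p)%:E.
  by rewrite sumEFin sumr_const mulr_natl.
apply: lee_sum => i _.
have := poweR_le_powR (ltW p0) (Lnorm_ge0 _ _ _) (Fc i).
by rewrite poweR_Lnorm ?gt_eqF.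
Qed.

End Lnorm_facts.

(** * L^p norms of random variables *)

Section probability.
Context d (T : measurableType d) (R : realType) (P : probability T R).
Local Open Scope ereal_scope.

Lemma Lnorm_cst_prob (a p : R) : (0 < p)%R ->
  'N[P]_(p%:E)[EFin \o cst a] = `|a|%:E.
Proof.
move=> p0; have := LnormZl P a (@measurable_cst _ _ T R setT 1%R) p0.
rewrite [X in 'N[P]_(_)[X]](_ : _ = EFin \o cst a); last first.
  by apply/funext => x/=; rewrite mulr1.
move=> ->; rewrite Lnorm_cst1 -[RHS]mule1 -(poweR1r p^-1).
by congr (_ * _ `^ _); exact: probability_setT.
Qed.

(** [Lnorm_mul_le] applied to [f] and the constant 1. *)
Lemma Lnorm_le_exponent (f : T -> R) (p q : R) :
  measurable_fun setT f -> (0 < p)%R -> (p < q)%R ->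
  'N[P]_(p%:E)[EFin \o f] <= 'N[P]_(q%:E)[EFin \o f].
Proof.
move=> mf p0 pq; have q0 := lt_trans p0 pq.
have m0 : (0 < (p^-1 - q^-1)^-1)%R.
  by rewrite invr_gt0 subr_gt0 ltf_pV2 ?posrE.
have := Lnorm_mul_le P mf (@measurable_cst _ _ T R setT 1%R) p0 q0 m0.
rewrite invrK subrKC Lnorm_cst_prob// normr1 mule1 => /(_ erefl).
by under [X in EFin \o X]eq_fun do rewrite /= mulr1.
Qed.

Lemma Lnorm_mean_sub_le (n : nat) (F : 'I_n -> T -> R) (a p C : R) :
  (0 < n)%N -> (1 <= p)%R -> (forall i, measurable_fun setT (F i)) ->
  (forall i, 'N[P]_(p%:E)[EFin \o F i] <= C%:E) ->
  'N[P]_(p%:E)[EFin \o (fun x => n%:R^-1 * \sum_(i < n) F i x - a)%R]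
    <= (C + `|a|)%:E.
Proof.
move=> n0 p1 mF FC; have p0 := lt_le_trans ltr01 p1.
have ms : measurable_fun setT (fun x => \sum_(i < n) F i x)%R.
  exact: measurable_sum.
rewrite EFinD -normrN -(Lnorm_cst_prob (- a) p0).
pose mean x := (n%:R^-1 * \sum_(i < n) F i x)%R.
have mmean : measurable_fun setT mean by exact: measurable_funM.
apply: (@le_trans _ _ ('N[P]_(p%:E)[EFin \o mean]
    + 'N[P]_(p%:E)[EFin \o cst (- a)%R])).
  exact: minkowski_EFin.
rewrite leeD2r// LnormZl// ger0_norm ?invr_ge0//.
apply: (@le_trans _ _ (n%:R^-1%:E * (n%:R * C)%:E)); last first.
  by rewrite -EFinM mulrA mulVf ?mul1r// pnatr_eq0 -lt0n.
rewrite lee_wpmul2l ?lee_fin ?invr_ge0//.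
apply: (le_trans (Lnorm_le_sum (l := index_enum 'I_n) ms mF p1 _)).
  by apply: aeW => x; exact: ler_norm_sum.
apply: (le_trans (lee_sum _ (fun i _ => FC i))).
by rewrite sumEFin sumr_const card_ord mulr_natl.
Qed.

End probability.

(** * The moment bound for the ratio *)

Theorem lemma1 (d : measure_display) (T : measurableType d) (R : realType)
    (P : probability T R) (n : nat) (U V : 'I_n -> {RV P >-> R})
    (p q r s alpha beta v C c : R)
    (U_ge0 : forall i, {ae P, forall x, 0 <= U i x})
    (D_gt0 : 0 < Dbar U)
    (v_gt0 : 0 < v) (C_gt0 : 0 < C) (c_gt0 : 0 < c)
    (p_ge1 : 1 <= p) (pq : p < q) (r_gt0 : 0 < r) (s_gt0 : 0 < s)
    (pqr : 1 <= q / p - q / r)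
    (pqs : q^-1 + s^-1 < p^-1)
    (alphaE : alpha = q * (p^-1 - s^-1 - q^-1))
    (betaE : beta^-1 = q * (p^-1 - r^-1))
    (alpha_le1 : alpha <= 1) (beta_le1 : 1 <= beta^-1)
    (N_le : ('N[P]_(p%:E)[EFin \o (fun x => Nhat U V x - Nbar U V)%R] <= v%:E)%E)
    (D_le : ('N[P]_(q%:E)[EFin \o (fun x => Dhat U x - Dbar U)%R] <= v%:E)%E)
    (UV_le : forall i, ('N[P]_(r%:E)[EFin \o (fun x => U i x * V i x)%R] <= C%:E)%E)
    (V_le : forall i, ('N[P]_(s%:E)[EFin \o V i] <= c%:E)%E) :
  ((Dbar U)%:E * 'N[P]_(p%:E)[EFin \o Delta U V] <=
   ((1 + `|Nbar U V| / Dbar U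
       + `|Nbar U V| `^ beta * v `^ (1 - beta) / Dbar U
       + C `^ beta * v `^ (1 - beta) / Dbar U
       + v `^ alpha * c * n%:R `^ s^-1 / Dbar U `^ alpha) * v)%:E)%E.
Proof.
have p0 : 0 < p := lt_le_trans ltr01 p_ge1.
have q0 : 0 < q := lt_trans p0 pq.
have n0 : (0 < n)%N.
  case: n U V D_gt0 {U_ge0 N_le D_le UV_le V_le} => [|//] U V.
  rewrite /Dbar (_ : Dhat U = cst 0); last first.
    by apply/funext => x; rewrite /Dhat big_ord0 mulr0.
  by rewrite expectation_cst ltxx.
have beta0 : 0 < beta by rewrite -invr_gt0 (lt_le_trans ltr01).
have beta1 : beta <= 1.
  by rewrite -[leRHS]invr1 -(invrK beta) lef_pV2 ?posrE// invr_gt0.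
have alpha0 : 0 < alpha.
  by rewrite alphaE mulr_gt0// -addrA -opprD subr_gt0 [s^-1 + _]addrC.
(* In fact [p <= r], because [beta^-1] is nonnegative. *)
have r1 : 1 <= r.
  have rp : r^-1 <= p^-1.
    by rewrite -subr_ge0 -(pmulr_rge0 _ q0) -betaE; exact: le_trans beta_le1.
  by apply: le_trans p_ge1 _; move: rp; rewrite lef_pV2 ?posrE.
(* [m] is the exponent that completes [q] to [p] in Hoelder's inequality. *)
pose m := (p^-1 - q^-1)^-1.
have pqV : 0 < p^-1 - q^-1 by rewrite subr_gt0 ltf_pV2 ?posrE.
have m0 : 0 < m by rewrite invr_gt0.
have mE : m^-1 = (1 - beta) / p + beta / r.
  have bq : q^-1 = beta * (p^-1 - r^-1).
    have -> : p^-1 - r^-1 = beta^-1 / q by rewrite betaE mulrC mulKf ?gt_eqF.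
    by rewrite mulrA mulfV ?mul1r// gt_eqF.
  by rewrite /m invrK bq; ring.
have aq0 : 0 < q / (1 + alpha) by rewrite divr_gt0// addr_gt0.
have pE : p^-1 = (q / (1 + alpha))^-1 + s^-1.
  by rewrite invf_div alphaE; field; rewrite !gt_eqF.
set D := Dbar U in D_gt0 D_le *; set N := Nbar U V in N_le *.
have mUV i : measurable_fun setT (fun x => U i x * V i x).
  exact: measurable_funM.
have mD : measurable_fun setT (Dhat U).
  by apply: measurable_funM => //; exact: measurable_sum.
have mN : measurable_fun setT (Nhat U V).
  by apply: measurable_funM => //; exact: measurable_sum.
pose X x := Dhat U x - D; pose Y x := Nhat U V x - N.
(* [M] dominates every [|V i|], hence also the weighted mean [Rhat U V]. *)
pose M x := (\sum_(i < n) `|V i x| `^ s) `^ s^-1.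
have mX : measurable_fun setT X by exact: measurable_funB.
have mY : measurable_fun setT Y by exact: measurable_funB.
have mM : measurable_fun setT M.
  apply: (@measurableT_comp _ _ _ _ _ _ (@powR R ^~ s^-1)) => //.
  by apply: measurable_sum => i; exact: measurable_norm_powR.
have M0 x : 0 <= M x by exact: powR_ge0.
have V_le_M x i : `|V i x| <= M x by exact: (norm_le_sum_powR (fun j => V j x)).
have M_le : ('N[P]_(s%:E)[EFin \o M] <= (c * n%:R `^ s^-1)%:E)%E.
  rewrite -[in n%:R](card_ord n).
  apply: (Lnorm_sum_powR_le s_gt0 (ltW c_gt0) _ V_le) => i.
  exact: measurable_funPT.
clearbody M.
have mDel : measurable_fun setT (Delta U V).
  apply: measurable_funB => //; apply: measurable_funM => //.
  exact: measurable_fun_inv.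
have Yr_le : ('N[P]_(r%:E)[EFin \o Y] <= (C + `|N|)%:E)%E.
  exact: Lnorm_mean_sub_le.
have Ym_le : ('N[P]_(m%:E)[EFin \o Y]
    <= (v `^ (1 - beta) * (C + `|N|) `^ beta)%:E)%E.
  apply: le_trans (Lnorm_interpolation P mY p0 r_gt0 m0 beta0 beta1 mE) _.
  rewrite [leRHS]EFinM lee_pmul ?poweR_ge0// poweR_le_powR ?Lnorm_ge0 ?subr_ge0//.
  exact: ltW.
have pm : p^-1 = q^-1 + m^-1 by rewrite /m invrK subrKC.
have Xp_le : ('N[P]_(p%:E)[EFin \o X] <= v%:E)%E.
  by apply: le_trans D_le; exact: Lnorm_le_exponent mX p0 pq.
have XY_le : ('N[P]_(p%:E)[EFin \o (X \* Y)%R]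
    <= (v * (v `^ (1 - beta) * (C + `|N|) `^ beta))%:E)%E.
  apply: le_trans (Lnorm_mul_le P mX mY p0 q0 m0 pm) _.
  by rewrite [leRHS]EFinM lee_pmul// Lnorm_ge0.
have XM_le : ('N[P]_(p%:E)[EFin \o ((fun x => `|X x| `^ (1 + alpha)) \* M)%R]
    <= (v `^ (1 + alpha) * (c * n%:R `^ s^-1))%:E)%E.
  apply: le_trans (Lnorm_mul_le P (measurable_norm_powR _ mX) mM p0 aq0 s_gt0 pE) _.
  have a1 : 0 < 1 + alpha by rewrite addr_gt0.
  rewrite [leRHS]EFinM lee_pmul ?Lnorm_ge0// Lnorm_powR//.
  rewrite mulrC divfK ?gt_eqF//.
  by apply: poweR_le_powR D_le; rewrite ?Lnorm_ge0// ltW.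
rewrite -{1}(gtr0_norm D_gt0) -LnormZl//.
(* The four terms of the pointwise bound [norm_ratio_error_le]. *)
pose G : 'I_4 -> T -> R := fun i => nth (cst 0) [::
  Y; fun x => `|N| / D * X x; fun x => D^-1 * (X \* Y)%R x;
  fun x => (D `^ alpha)^-1 * ((fun x => `|X x| `^ (1 + alpha)) \* M) x] i.
have mXY : measurable_fun setT (X \* Y)%R by exact: measurable_funM.
have mXM : measurable_fun setT ((fun x => `|X x| `^ (1 + alpha)) \* M).
  by apply: measurable_funM => //; exact: measurable_norm_powR.
have mG i : measurable_fun setT (G i).
  by case: i => [[|[|[|[|//]]]] ?]; rewrite /G//=; exact: measurable_funM.
have Delta_le : {ae P, forall x, `|D * Delta U V x| <= \sum_(i < 4) `|G i x|}.
  have : {ae P, forall x, forall i, 0 <= U i x} by exact: filter_forall.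
  apply: filterS => x U0; rewrite !big_ord_recl big_ord0 addr0.
  have Dx0 : 0 <= Dhat U x by rewrite mulr_ge0 ?invr_ge0// sumr_ge0.
  have Nx_le : `|Nhat U V x| <= Dhat U x * M x by exact: norm_weighted_sum_le.
  have := norm_ratio_error_le N D_gt0 Dx0 (M0 x) Nx_le alpha0 alpha_le1.
  rewrite /G/= !normrM !normr_id (ger0_norm (powR_ge0 _ _)) (ger0_norm (M0 x)).
  by rewrite !normfV (gtr0_norm D_gt0) (ger0_norm (powR_ge0 _ _)).
apply: (le_trans (Lnorm_le_sum _ mG p_ge1 Delta_le)).
  exact: measurable_funM.
rewrite !big_ord_recl big_ord0 adde0 /G/= !LnormZl//.
have DV0 : 0 <= D^-1 by rewrite invr_ge0 ltW.
have ND0 : 0 <= `|N| / D by rewrite mulr_ge0.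
have DaV0 : 0 <= (D `^ alpha)^-1 by rewrite invr_ge0 powR_ge0.
rewrite (ger0_norm ND0) (ger0_norm DV0) (ger0_norm DaV0).
apply: (@le_trans _ _ (v + (`|N| / D * v +
    (D^-1 * (v * (v `^ (1 - beta) * (C + `|N|) `^ beta)) +
     (D `^ alpha)^-1 * (v `^ (1 + alpha) * (c * n%:R `^ s^-1)))))%:E).
  by rewrite !EFinD; apply: leeD N_le (leeD _ (leeD _ _));
    rewrite [leRHS]EFinM lee_wpmul2l.
have CN_le : (C + `|N|) `^ beta <= C `^ beta + `|N| `^ beta.
  by rewrite powRD_subadd// ltW.
rewrite lee_fin [v `^ (1 + alpha)]powRD; last first.
  by rewrite (gt_eqF v_gt0) implybT.
rewrite powRr1 ?(ltW v_gt0)//.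
set vb := v `^ (1 - beta); set w := c * _; set va := v `^ alpha.
set Da := D `^ alpha.
apply: (@le_trans _ _ (v + (`|N| / D * v +
    (D^-1 * (v * (vb * (C `^ beta + `|N| `^ beta))) + Da^-1 * (v * va * w))))).
  rewrite !lerD2l lerD2r ler_wpM2l// ler_wpM2l ?(ltW v_gt0)//.
  by rewrite ler_wpM2l ?powR_ge0.
by rewrite le_eqVlt; apply/orP; left; apply/eqP; rewrite /w; ring.
Qed.
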